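(* For interval-valued hesitant fuzzy soft sets $F_A$, $G_B$, $H_C$ over $(U,E)$ with (possibly different) nonempty parameter sets $A,B,C\subseteq E$, the following two identities do not hold in general: (i) $F_A\tilde{\cup}(G_B\tilde{\cap}H_C)=(F_A\tilde{\cup}G_B)\tilde{\cap}(F_A\tilde{\cup}H_C)$; (ii) $F_A\tilde{\cap}(G_B\tilde{\cup}H_C)=(F_A\tilde{\cap}G_B)\tilde{\cup}(F_A\tilde{\cap}H_C)$. That is, for each of (i) and (ii) there exist $U$, $E$ and interval-valued hesitant fuzzy soft sets $F_A,G_B,H_C$ over $(U,E)$, with all the intersections occurring in the identity defined, for which the two sides are not equal.
   Context: $U$ is an initial universe and $E$ a set of parameters. An interval-valued hesitant fuzzy element (IVHFE) is a nonempty set of closed intervals $\gamma=[\gamma^L,\gamma^U]\subseteq[0,1]$. For IVHFEs $\mu_1,\mu_2$: $\mu_1\cup\mu_2=\{[\max(\gamma_1^L,\gamma_2^L),\max(\gamma_1^U,\gamma_2^U)]:\gamma_1\in\mu_1,\gamma_2\in\mu_2\}$ and $\mu_1\cap\mu_2=\{[\min(\gamma_1^L,\gamma_2^L),\min(\gamma_1^U,\gamma_2^U)]:\gamma_1\in\mu_1,\gamma_2\in\mu_2\}$. An interval-valued hesitant fuzzy soft set $F_A$ over $(U,E)$, with $A\subseteq E$, assigns to each $e\in A$ and each $h\in U$ an IVHFE $\mu_{F(e)}(h)$. Two such sets are equal when they have the same parameter set and the same IVHFE for every $e$ and $h$. The union $F_A\tilde\cup G_B$ has parameter set $A\cup B$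 and its value at $(e,h)$ is $\mu_{F(e)}(h)$ if $e\in A\setminus B$, $\mu_{G(e)}(h)$ if $e\in B\setminus A$, and $\mu_{F(e)}(h)\cup\mu_{G(e)}(h)$ if $e\in A\cap B$. The intersection $F_A\tilde\cap G_B$, defined when $A\cap B\neq\emptyset$, has parameter set $A\cap B$ and values $\mu_{F(e)}(h)\cap\mu_{G(e)}(h)$. *)

(* Defs.v *)
From HB Require Import structures.
From mathcomp Require Import all_boot all_order all_algebra.
From mathcomp Require Import boolp classical_sets reals.

Set Implicit Arguments.
Unset Strict Implicit.
Unset Printing Implicit Defensive.

Import Order.TTheory GRing.Theory Num.Theory.
Local Open Scope classical_set_scope.
Local Open Scope ring_scope.

(* A nonempty closed interval [lo, hi] contained in [0, 1], given by its end
   points; degenerate intervals lo = hi are allowed. *)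
Record subint (R : realType) := SubInt {
  lo : R;
  hi : R;
  subintP : [&& 0 <= lo, lo <= hi & hi <= 1] }.

Section IntervalOps.
Variable R : realType.
Implicit Types g : subint R.

Lemma subint_max_proof g1 g2 :
  [&& 0 <= Num.max (lo g1) (lo g2),
      Num.max (lo g1) (lo g2) <= Num.max (hi g1) (hi g2)
    & Num.max (hi g1) (hi g2) <= 1].
Proof.
case: g1 g2 => [a b /and3P[a0 ab b1]] [c d /and3P[c0 cd d1]] /=.
by rewrite le_max a0 /= !ge_max !le_max ab cd b1 d1 /= orbT.
Qed.

Lemma subint_min_proof g1 g2 :
  [&& 0 <= Num.min (lo g1) (lo g2),
      Num.min (lo g1) (lo g2) <= Num.min (hi g1) (hi g2)
    & Num.min (hi g1) (hi g2) <= 1].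
Proof.
case: g1 g2 => [a b /and3P[a0 ab b1]] [c d /and3P[c0 cd d1]] /=.
by rewrite !le_min a0 c0 !ge_min ab cd b1 /= orbT.
Qed.

Definition subint_max g1 g2 : subint R := SubInt (subint_max_proof g1 g2).
Definition subint_min g1 g2 : subint R := SubInt (subint_min_proof g1 g2).

End IntervalOps.

(* IVHFE: interval-valued hesitant fuzzy element. *)
Record ivhfe (R : realType) := IVHFE {
  ivals : set (subint R);
  ivals_neq0 : ivals !=set0 }.

Section ElementOps.
Variable R : realType.
Implicit Types m : ivhfe R.

Lemma image2_neq0 (f : subint R -> subint R -> subint R) m1 m2 :
  [set f g1 g2 | g1 in ivals m1 & g2 in ivals m2] !=set0.
Proof.
case: m1 m2 => [s1 [g1 s1g1]] [s2 [g2 s2g2]].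
by exists (f g1 g2); exists g1 => //; exists g2.
Qed.

Definition ivhfe_union m1 m2 : ivhfe R :=
  IVHFE (image2_neq0 (@subint_max R) m1 m2).

Definition ivhfe_inter m1 m2 : ivhfe R :=
  IVHFE (image2_neq0 (@subint_min R) m1 m2).

End ElementOps.

(* IVHFSS: interval-valued hesitant fuzzy soft set over (U, E). The values are only
   given at the parameters belonging to [params]. *)
Record ivhfss (R : realType) (U E : Type) := IVHFSS {
  params : set E;
  mu : forall e : E, params e -> U -> ivhfe R }.

Section SoftSetOps.
Variables (R : realType) (U E : Type).
Implicit Types F G : ivhfss R U E.

Definition ivhfss_eq F G : Prop :=
  params F = params G /\
  forall (e : E) (eF : params F e) (eG : params G e) (h : U),
    mu eF h = mu eG h.

Lemma setU_absurd (A B : set E) (e : E) :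
  (A `|` B) e -> ~ A e -> ~ B e -> False.
Proof. by case. Qed.

Definition ivhfss_union F G : ivhfss R U E :=
  @IVHFSS R U E (params F `|` params G)
    (fun e eFG h =>
       match pselect (params F e), pselect (params G e) with
       | left eF, left eG => ivhfe_union (mu eF h) (mu eG h)
       | left eF, right _ => mu eF h
       | right _, left eG => mu eG h
       | right neF, right neG => False_rect _ (setU_absurd eFG neF neG)
       end).

(* The last argument makes the intersection defined only for soft sets with a
   common parameter. *)
Definition ivhfss_inter F G (FG : params F `&` params G !=set0) :
    ivhfss R U E :=
  @IVHFSS R U E (params F `&` params G)
    (fun e eFG h => ivhfe_inter (mu (proj1 eFG) h) (mu (proj2 eFG) h)).

End SoftSetOps.

(* Main.v *)
Require Import Defs.
From HB Require Import structures.
From mathcomp Require Import all_boot all_order all_algebra.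
From mathcomp Require Import boolp classical_sets reals.

Local Open Scope classical_set_scope.

Import Order.TTheory GRing.Theory Num.Theory.

(** When intervals are ordered by comparing both end points, [subint_max] and
    [subint_min] are the join and the meet of a distributive lattice, so the
    two identities do hold for single intervals. They fail for hesitant
    elements because the right-hand sides mention [F] twice, and the two
    occurrences may select different members of the same set.

    The intervals [[0, 0]], [[0, 1]], [[1, 1]] form a chain 0 < m < 1. Take one
    object and one parameter, F = {0, 1} and G = {m}. For (i) let H = {0}: the
    left-hand side {max(f, min(m, 0)) : f in F} is {0, 1}, while selecting
    f = 0 and then f' = 1 on the right gives min(max(0, m), max(1, 0)) = m.
    For (ii) let H = {1}: the left-hand side {min(f, max(m, 1)) : f in F} is
    again {0, 1}, while f = 1 and f' = 0 give max(min(1, m), min(0, 1)) = m. *)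

Section Witnesses.
Set Implicit Arguments.
Unset Strict Implicit.
Variable R : realType.

Lemma zero_intP : [&& (0 : R) <= 0, (0 : R) <= 0 & (0 : R) <= 1]%R.
Proof. by rewrite lexx ler01. Qed.

Lemma unit_intP : [&& (0 : R) <= 0, (0 : R) <= 1 & (1 : R) <= 1]%R.
Proof. by rewrite !lexx ler01. Qed.

Lemma one_intP : [&& (0 : R) <= 1, (1 : R) <= 1 & (1 : R) <= 1]%R.
Proof. by rewrite lexx ler01. Qed.

(** The chain 0 < m < 1: the degenerate interval at 0, the whole of [[0, 1]],
    and the degenerate interval at 1. *)
Definition zero_int : subint R := SubInt zero_intP.
Definition unit_int : subint R := SubInt unit_intP.
Definition one_int : subint R := SubInt one_intP.

Lemma subint_eq (g1 g2 : subint R) : lo g1 = lo g2 -> hi g1 = hi g2 -> g1 = g2.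
Proof.
case: g1 g2 => [a b p] [c d q] /= ac bd; subst c d.
by rewrite (bool_irrelevance p q).
Qed.

(** The hesitant element with the two members [g1] and [g2]; it is a singleton
    when they coincide. *)
Definition pair_ivhfe (g1 g2 : subint R) : ivhfe R :=
  @IVHFE R [set g1; g2] (ex_intro _ g1 (or_introl erefl)).

(** The soft set with one object, one parameter, and the single value [m]. *)
Definition const_ivhfss (m : ivhfe R) : ivhfss R unit unit :=
  @IVHFSS R unit unit setT (fun _ _ _ => m).

(** At a parameter common to both sets, the value of a union depends on neither
    the case distinction nor the membership proofs. *)
Lemma mu_union (U E : Type) (F G : ivhfss R U E) (e : E)
    (eFG : params (ivhfss_union F G) e) (eF : params F e) (eG : params G e)
    (h : U) :
  mu eFG h = ivhfe_union (mu eF h) (mu eG h).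
Proof.
rewrite /=; case: pselect => [eF'|//]; case: pselect => [eG'|//].
by rewrite (Prop_irrelevance eF' eF) (Prop_irrelevance eG' eG).
Qed.

(** Over a single parameter, each identity between soft sets reduces to the same
    identity between their values. *)
Lemma const_union_inter_eq (m n p : ivhfe R) GH FG_FH :
  ivhfss_eq
    (ivhfss_union (const_ivhfss m)
       (@ivhfss_inter _ _ _ (const_ivhfss n) (const_ivhfss p) GH))
    (@ivhfss_inter _ _ _ (ivhfss_union (const_ivhfss m) (const_ivhfss n))
       (ivhfss_union (const_ivhfss m) (const_ivhfss p)) FG_FH) ->
  ivhfe_union m (ivhfe_inter n p) =
  ivhfe_inter (ivhfe_union m n) (ivhfe_union m p).
Proof.
case=> _ /(_ tt (or_introl I) (conj (or_introl I) (or_introl I)) tt).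
rewrite (mu_union (F := const_ivhfss m) (G := ivhfss_inter GH) _ I (conj I I)).
move=> /= ->; congr ivhfe_inter.
- exact: (mu_union (F := const_ivhfss m) (G := const_ivhfss n) _ I I).
- exact: (mu_union (F := const_ivhfss m) (G := const_ivhfss p) _ I I).
Qed.

Lemma const_inter_union_eq (m n p : ivhfe R) F_GH FG FH :
  ivhfss_eq
    (@ivhfss_inter _ _ _ (const_ivhfss m)
       (ivhfss_union (const_ivhfss n) (const_ivhfss p)) F_GH)
    (ivhfss_union
       (@ivhfss_inter _ _ _ (const_ivhfss m) (const_ivhfss n) FG)
       (@ivhfss_inter _ _ _ (const_ivhfss m) (const_ivhfss p) FH)) ->
  ivhfe_inter m (ivhfe_union n p) =
  ivhfe_union (ivhfe_inter m n) (ivhfe_inter m p).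
Proof.
case=> _ /(_ tt (conj I (or_introl I)) (or_introl (conj I I)) tt).
rewrite (mu_union (F := ivhfss_inter FG) (G := ivhfss_inter FH) _
  (conj I I) (conj I I)).
move=> /= <-; congr ivhfe_inter.
exact/esym/(mu_union (F := const_ivhfss n) (G := const_ivhfss p) _ I I).
Qed.

Lemma ivhfe_union_interDr_fails :
  let mF := pair_ivhfe zero_int one_int in
  let mG := pair_ivhfe unit_int unit_int in
  let mH := pair_ivhfe zero_int zero_int in
  ivhfe_union mF (ivhfe_inter mG mH) <>
  ivhfe_inter (ivhfe_union mF mG) (ivhfe_union mF mH).
Proof.
move=> mF mG mH distr.
have : ivals (ivhfe_inter (ivhfe_union mF mG) (ivhfe_union mF mH)) unit_int.
  (* m = min(max(0, m), max(1, 0)) *)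
  exists (subint_max zero_int unit_int).
    by exists zero_int; [left|exists unit_int; [left|]].
  exists (subint_max one_int zero_int).
    by exists one_int; [right|exists zero_int; [left|]].
  by apply: subint_eq; rewrite /= ?maxxx ?(max_r ler01) ?(max_l ler01)
    ?(min_l ler01) ?minxx.
rewrite -distr => -[f mf [_ [g ng [h ph <-]]]].
have -> : g = unit_int by case: ng.
have -> : h = zero_int by case: ph.
(* max(f, min(m, 0)) = f: upper end points separate f = 0 from m, lower ones
   separate f = 1 from m. *)
case: mf => -> E.
- have := congr1 (@hi R) E.
  by rewrite /= (min_r ler01) maxxx => /esym /eqP; rewrite oner_eq0.
- have := congr1 (@lo R) E.
  by rewrite /= minxx (max_l ler01) => /eqP; rewrite oner_eq0.
Qed.

Lemma ivhfe_inter_unionDr_fails :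
  let mF := pair_ivhfe zero_int one_int in
  let mG := pair_ivhfe unit_int unit_int in
  let mH := pair_ivhfe one_int one_int in
  ivhfe_inter mF (ivhfe_union mG mH) <>
  ivhfe_union (ivhfe_inter mF mG) (ivhfe_inter mF mH).
Proof.
move=> mF mG mH distr.
have : ivals (ivhfe_union (ivhfe_inter mF mG) (ivhfe_inter mF mH)) unit_int.
  (* m = max(min(1, m), min(0, 1)) *)
  exists (subint_min one_int unit_int).
    by exists one_int; [right|exists unit_int; [left|]].
  exists (subint_min zero_int one_int).
    by exists zero_int; [left|exists one_int; [left|]].
  by apply: subint_eq; rewrite /= ?minxx ?(min_r ler01) ?(min_l ler01)
    ?(max_l ler01) ?maxxx.
rewrite -distr => -[f mf [_ [g ng [h ph <-]]]].
have -> : g = unit_int by case: ng.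
have -> : h = one_int by case: ph.
(* min(f, max(m, 1)) = f: upper end points separate f = 0 from m, lower ones
   separate f = 1 from m. *)
case: mf => -> E.
- have := congr1 (@hi R) E.
  by rewrite /= maxxx (min_l ler01) => /esym /eqP; rewrite oner_eq0.
- have := congr1 (@lo R) E.
  by rewrite /= (max_r ler01) minxx => /eqP; rewrite oner_eq0.
Qed.

End Witnesses.

Theorem proposition3p11 (R : realType) :
  (exists (U E : Type) (F G H : ivhfss R U E)
     (GH : params G `&` params H !=set0)
     (FG_FH : params (ivhfss_union F G) `&` params (ivhfss_union F H) !=set0),
     [/\ params F !=set0, params G !=set0, params H !=set0 &
         ~ ivhfss_eq (ivhfss_union F (ivhfss_inter GH))
                     (ivhfss_inter FG_FH)]) /\
  (exists (U E : Type) (F G H : ivhfss R U E)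
     (F_GH : params F `&` params (ivhfss_union G H) !=set0)
     (FG : params F `&` params G !=set0)
     (FH : params F `&` params H !=set0),
     [/\ params F !=set0, params G !=set0, params H !=set0 &
         ~ ivhfss_eq (ivhfss_inter F_GH)
                     (ivhfss_union (ivhfss_inter FG) (ivhfss_inter FH))]).
Proof.
pose F := const_ivhfss (pair_ivhfe (zero_int R) (one_int R)).
pose G := const_ivhfss (pair_ivhfe (unit_int R) (unit_int R)).
split; exists unit, unit, F, G.
- exists (const_ivhfss (pair_ivhfe (zero_int R) (zero_int R))).
  exists (ex_intro _ tt (conj I I)).
  exists (ex_intro _ tt (conj (or_introl I) (or_introl I))).
  split; [by exists tt | by exists tt | by exists tt |].
  by move=> /const_union_inter_eq; exact: ivhfe_union_interDr_fails.
- exists (const_ivhfss (pair_ivhfe (one_int R) (one_int R))).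
  exists (ex_intro _ tt (conj I (or_introl I))).
  exists (ex_intro _ tt (conj I I)), (ex_intro _ tt (conj I I)).
  split; [by exists tt | by exists tt | by exists tt |].
  by move=> /const_inter_union_eq; exact: ivhfe_inter_unionDr_fails.
Qed.
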